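(* Denote $$\mathbb F_t(\mathbf x,\mathbf z)=\sum_{i=1}^N\Big\{f_t^i(x^i)+\frac{\lambda_1^i}{2}\|x^i-x_{t-1}^i\|_2^2+\beta\sum_{\mathcal E_t\ni e\ni i}\|A_t^e x^i-A_t^e z_e\|_2^2\Big\},\qquad \lambda_1^i=\frac{2}{1+\sqrt{1+4/\mu_i}},$$ where $x_{t-1}^i$ is the action of agent $i$ taken in the previous round. Then the sequence of actions $\{\tilde{\mathbf x}_t\}_{t=1}^T$ obtained by solving, in each round (with $x_{t-1}^i=\tilde x_{t-1}^i$), $$(\tilde{\mathbf x}_t,\mathbf z_* )=\arg\min_{\mathbf x=(x^i)_{i=1}^N,\ \mathbf z=(z_e)_{e\in\mathcal E_t}}\mathbb F_t(\mathbf x,\mathbf z)$$ is guaranteed to have the optimal (i.e. smallest achievable by an online algorithm on the class of instances with given $\min_i\mu_i$) competitive ratio $$\frac12+\frac12\sqrt{1+\frac{4}{\min_i\mu_i}}.$$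
   Context: There are $N$ agents and rounds $t=1,\dots,T$. In round $t$ agent $i$ receives a nonnegative $\mu_i$-strongly convex hitting cost $f_t^i:\mathbb{R}^d\to[0,\infty)$ ($\mu_i>0$) and picks $x_t^i\in\mathbb{R}^d$. An undirected graph $\mathcal G_t=([N],\mathcal E_t)$ (arbitrary, changing with $t$) is revealed, with for each edge $e=(i,j)\in\mathcal E_t$ a matrix $A_t^{e}\in\mathbb{R}^{r_t\times d}$, $r_t\ge d$, of full rank $d$ with singular values in $[\sqrt m,\sqrt l]$, $0<m\le l$. Let $\beta>0$. From a common fixed initial point $\mathbf x_0$, the cost of $\mathbf x_t=(x_t^1,\dots,x_t^N)$ is $$\mathrm{Cost}[1,T]=\sum_{t=1}^T\Big\{\sum_{i=1}^N\big(f_t^i(x_t^i)+\tfrac12\|x_t^i-x_{t-1}^i\|_2^2\big)+\tfrac{\beta}{2}\sum_{(i,j)\in\mathcal E_t}\|A_t^{(i,j)}x_t^i-A_t^{(i,j)}x_t^j\|_2^2\Big\}.$$ OPT is the offline (hindsight) minimizer. An online algorithm chooses $\mathbf x_t$ using only information revealed up to and including round $t$. ALG has (asymptotic) competitive ratio $C$ if $\mathrm{Cost}_{\mathrm{ALG}}[1,T]\le C\cdot\mathrm{Cost}_{\mathrm{OPT}}[1,T]+o(1)$ for all instances, where the $o(1)$ term tends to $0$ as $T\to\infty$ and is instance-independent. $\sum_{\mathcal E_t\ni e\ni i}$ denotes the sum over edges $e\in\mathcal E_t$ incident to $i$; $z_e\in\mathbb{R}^d$. *)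

(* Defs.v *)
From HB Require Import structures.
From mathcomp Require Import all_boot all_order all_algebra.
From mathcomp Require Import all_classical all_reals all_analysis.

Set Implicit Arguments.
Unset Strict Implicit.
Unset Printing Implicit Defensive.

Import Order.TTheory GRing.Theory Num.Theory.
Import numFieldNormedType.Exports.

Local Open Scope classical_set_scope.
Local Open Scope ring_scope.

(* Squared Euclidean norm; the library norm [`|v|] on matrices is the
   sup norm. *)
Definition sqnorm2 (R : realType) (n : nat) (v : 'cV[R]_n) : R :=
  \sum_(k < n) v k 0 ^+ 2.

Definition strongly_convex (R : realType) (d : nat) (mu : R)
    (f : 'cV[R]_d -> R) : Prop :=
  forall (x y : 'cV[R]_d) (a : R), 0 <= a -> a <= 1 ->
    f (a *: x + (1 - a) *: y) <=
    a * f x + (1 - a) * f y - mu / 2 * a * (1 - a) * sqnorm2 (x - y).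

(* For [d <= r], the singular values of [A] are the square roots of the [d]
   eigenvalues of the Gram matrix, possible zeros included. *)
Definition singular_value (R : realType) (r d : nat) (A : 'M[R]_(r, d))
    (s : R) : Prop :=
  0 <= s /\ eigenvalue (A^T *m A) (s ^+ 2).

(* The joint action [(x^1, ..., x^N)] of the agents. *)
Definition action (R : realType) (N d : nat) : Type := 'I_N -> 'cV[R]_d.

(* What is revealed in one round.  An undirected edge {i, j} is represented
   once, by the pair [(i, j)] with [i < j] (see [valid_round]).  The values of
   [link] outside [edges] are never used by the costs. *)
Record round (R : realType) (N d : nat) := Round {
  hit : 'I_N -> 'cV[R]_d -> R;
  edges : {set 'I_N * 'I_N};
  link_rows : nat;
  link : 'I_N * 'I_N -> 'M[R]_(link_rows, d) }.

Definition valid_round (R : realType) (N d : nat) (m l : R) (mu : 'I_N -> R)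
    (rd : round R N d) : Prop :=
  [/\ forall i x, 0 <= hit rd i x,
      forall i, strongly_convex (mu i) (hit rd i),
      forall e, e \in edges rd -> (e.1 < e.2)%N,
      (d <= link_rows rd)%N
    & forall e, e \in edges rd ->
        \rank (link rd e) = d /\
        forall s, singular_value (link rd e) s ->
          Num.sqrt m <= s /\ s <= Num.sqrt l].

(* [rounds inst t] is the data of round [t] for [1 <= t <= horizon inst]; the
   other values of [rounds inst] are irrelevant. *)
Record instance (R : realType) (N d : nat) := Instance {
  modulus : 'I_N -> R;
  horizon : nat;
  rounds : nat -> round R N d }.

Definition is_min (R : realType) (N : nat) (mu : 'I_N -> R) (mu0 : R) : Prop :=
  (exists i, mu i = mu0) /\ (forall i, mu0 <= mu i).

(* The class of instances for which [min_i mu_i] is equal to [mu0]. *)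
Definition instance_class (R : realType) (N d : nat) (m l mu0 : R)
    (inst : instance R N d) : Prop :=
  [/\ is_min (modulus inst) mu0, (0 < horizon inst)%N
    & forall t, (1 <= t <= horizon inst)%N ->
        valid_round m l (modulus inst) (rounds inst t)].

Definition round_cost (R : realType) (N d : nat) (beta : R)
    (rd : round R N d) (xprev x : action R N d) : R :=
  \sum_(i < N) (hit rd i (x i) + 2^-1 * sqnorm2 (x i - xprev i)) +
  beta / 2 * \sum_(e in edges rd)
    sqnorm2 (link rd e *m x e.1 - link rd e *m x e.2).

(* [x t] is the action of round [t], and [x 0] the initial point. *)
Definition cost (R : realType) (N d : nat) (beta : R) (inst : instance R N d)
    (x : nat -> action R N d) : R :=
  \sum_(1 <= t < (horizon inst).+1)
    round_cost beta (rounds inst t) (x t.-1) (x t).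

Definition opt_cost (R : realType) (N d : nat) (beta : R) (x0 : action R N d)
    (inst : instance R N d) : R :=
  inf [set cost beta inst x | x in [set x : nat -> action R N d | x 0%N = x0]].

(* An online algorithm maps the moduli, the horizon and the data of rounds
   [1, ..., t] to the action of round [t]. *)
Definition online_algorithm (R : realType) (N d : nat) : Type :=
  ('I_N -> R) -> nat -> seq (round R N d) -> action R N d.

Definition trajectory (R : realType) (N d : nat) (x0 : action R N d)
    (alg : online_algorithm R N d) (inst : instance R N d) (t : nat) :
    action R N d :=
  if t is 0%N then x0
  else alg (modulus inst) (horizon inst) [seq rounds inst s | s <- iota 1 t].

Definition has_competitive_ratio (R : realType) (N d : nat)
    (beta m l mu0 : R) (x0 : action R N d) (alg : online_algorithm R N d)
    (C : R) : Prop :=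
  exists2 eps : nat -> R, eps @ \oo --> (0 : R) &
    forall inst : instance R N d, instance_class m l mu0 inst ->
      cost beta inst (trajectory x0 alg inst) <=
      C * opt_cost beta x0 inst + eps (horizon inst).

Definition lambda1 (R : realType) (mu : R) : R :=
  2 / (1 + Num.sqrt (1 + 4 / mu)).

Definition edge (R : realType) (N d : nat) (rd : round R N d) : Type :=
  {e : 'I_N * 'I_N | e \in edges rd}.

Definition round_objective (R : realType) (N d : nat) (beta : R)
    (mu : 'I_N -> R) (rd : round R N d) (xprev : action R N d)
    (x : action R N d) (z : edge rd -> 'cV[R]_d) : R :=
  \sum_(i < N)
    (hit rd i (x i) + lambda1 (mu i) / 2 * sqnorm2 (x i - xprev i) +
     beta * \sum_(e : {e | e \in edges rd} |
                    (i == (val e).1) || (i == (val e).2))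
       sqnorm2 (link rd (val e) *m x i - link rd (val e) *m z e)).

Definition is_argmin (R : realType) (N d : nat) (beta : R)
    (mu : 'I_N -> R) (rd : round R N d) (xprev : action R N d)
    (xz : action R N d * (edge rd -> 'cV[R]_d)) : Prop :=
  forall (x : action R N d) (z : edge rd -> 'cV[R]_d),
    round_objective beta mu xprev xz.1 xz.2 <=
    round_objective beta mu xprev x z.

Definition argmin_step (R : realType) (N d : nat) (beta : R)
    (mu : 'I_N -> R) (xprev : action R N d) (rd : round R N d) :
    action R N d :=
  (xget ((xprev, fun=> 0) : ('I_N -> 'cV[R]_d) * (edge rd -> 'cV[R]_d))
        [set xz | is_argmin beta mu xprev xz]).1.

(* The sequence of actions starting at [x0] in which every action is the
   [x]-component of the minimizer of [round_objective] relative to the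
   previous action. *)
Definition argmin_algorithm (R : realType) (N d : nat) (beta : R)
    (x0 : action R N d) : online_algorithm R N d :=
  fun mu _ history => foldl (argmin_step beta mu) x0 history.

(* Main.v *)
Require Import Defs.
From HB Require Import structures.
From mathcomp Require Import all_boot all_order all_algebra.
From mathcomp Require Import all_classical all_reals all_analysis.
From mathcomp Require Import ring lra.

Set Implicit Arguments.
Unset Strict Implicit.
Unset Printing Implicit Defensive.

Import Order.TTheory GRing.Theory Num.Theory.
Import numFieldNormedType.Exports.

Local Open Scope classical_set_scope.
Local Open Scope ring_scope.

(** Write [lam mu] for [lambda1 mu]; it is the root in (0, 1) of
    [lam ^+ 2 = mu * (1 - lam)], and the ratio of the theorem is
    [(lambda1 mu0)^-1] (lemma [invr_lambda1]).

    Minimizing the edge terms over the auxiliary variables [z] puts every [z e]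
    at the midpoint of its endpoints, because the links have full rank, and
    leaves exactly the original coupling cost ([round_objectiveE]).  What
    remains is a nonnegative strongly convex function of the joint action; a
    finite convex function on a finite-dimensional space is lower
    semicontinuous, so a minimizing sequence, which is Cauchy, converges to a
    minimizer ([strongly_convex_argmin]).  Strong convexity gives uniqueness,
    and also the quadratic growth away from the minimizer on which the upper
    bound rests.

    Upper bound.  Let [x] be the trajectory of the algorithm and [y] any other
    trajectory.  Growth at the minimizer [x t], compared with the competitor
    [y t], yields in each round
      cost of x + c * potential(y t, x t)
        <= c * (cost of y + potential(y t.-1, x t.-1)),
    where [c = (lambda1 mu0)^-1] and the potential is the sum over the agents
    of [(mu i + lam (mu i)) / 2] times the squared distance
    ([argmin_round_le]).  The movement of [y] is brought in by Young's
    inequality, and the weights match because [(mu + lam) * (1 - lam) = lam]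
    ([lambda1_young]).  The inequalities telescope, so the additive term of the
    competitive ratio is zero.

    Lower bound.  No edge is ever present, and the hitting costs keep every
    agent near its initial point with modulus [mu0] until the last round, when
    a very stiff cost attracts it to a point at distance one.  The direction of
    the jump is opposite to the side on which the algorithm has put the agent,
    so the jump costs it nearly 1/2 ([adversary_alg_cost]).  Knowing the
    direction, one can approach the target geometrically at the rate
    [1 - lambda1 mu0], for a cost that tends to [lambda1 mu0 / 2] with the
    horizon ([adversary_opt_cost]). *)

(** * Squared Euclidean norms *)

Lemma sqnorm2_ge0 (R : realType) (n : nat) (v : 'cV[R]_n) : 0 <= sqnorm2 v.
Proof. by apply: sumr_ge0 => k _; rewrite sqr_ge0. Qed.

Lemma sqnorm20 (R : realType) (n : nat) : sqnorm2 (0 : 'cV[R]_n) = 0.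
Proof. by apply: big1 => k _; rewrite mxE expr0n. Qed.

Lemma sqnorm2_coord (R : realType) (n : nat) (v : 'cV[R]_n) (k : 'I_n) :
  v k 0 ^+ 2 <= sqnorm2 v.
Proof.
rewrite /sqnorm2 (bigD1 k) //= lerDl.
by apply: sumr_ge0 => j _; rewrite sqr_ge0.
Qed.

Lemma sqnorm2_le0 (R : realType) (n : nat) (v : 'cV[R]_n) :
  sqnorm2 v <= 0 -> v = 0.
Proof.
move=> v0; apply/colP => k; rewrite mxE; apply/eqP.
by rewrite -sqrf_eq0 eq_le sqr_ge0 andbT (le_trans (sqnorm2_coord v k)).
Qed.

(** The squared norm satisfies the inequality of strong convexity with
    equality; this is why quadratic terms add to the modulus exactly. *)
Lemma sqnorm2_convex (R : realType) (n : nat) (a : R) (x y : 'cV[R]_n) :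
  sqnorm2 (a *: x + (1 - a) *: y) =
  a * sqnorm2 x + (1 - a) * sqnorm2 y - a * (1 - a) * sqnorm2 (x - y).
Proof.
rewrite /sqnorm2 !mulr_sumr -big_split -sumrB /=; apply: eq_bigr => k _.
by rewrite !mxE; ring.
Qed.

(** Apollonius's identity, which eliminates an edge variable: only the last term
    depends on [z], and it vanishes at the midpoint of [x] and [y]. *)
Lemma sqnorm2_apollonius (R : realType) (n : nat) (x y z : 'cV[R]_n) :
  sqnorm2 (x - z) + sqnorm2 (y - z) =
  2^-1 * sqnorm2 (x - y) + 2 * sqnorm2 (2^-1 *: (x + y) - z).
Proof.
rewrite /sqnorm2 !mulr_sumr -!big_split /=; apply: eq_bigr => k _.
by rewrite !mxE; field.
Qed.

(** Young's inequality with the conjugate weights [s^-1] and [(1 - s)^-1]: the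
    difference of the two sides is a multiple of the squared
    norm of [(1 - s) * (x - y) - s * (y - z)]. *)
Lemma sqnorm2_young (R : realType) (n : nat) (s : R) (x y z : 'cV[R]_n) :
  0 < s < 1 ->
  sqnorm2 (x - z) <= s^-1 * sqnorm2 (x - y) + (1 - s)^-1 * sqnorm2 (y - z).
Proof.
case/andP=> s0 s1; rewrite /sqnorm2 !mulr_sumr -big_split /=.
apply: ler_sum => k _; rewrite !mxE -subr_ge0.
set a := x k 0; set b := y k 0; set c := z k 0.
have s1' : 0 < 1 - s by lra.
have -> : s^-1 * (a - b) ^+ 2 + (1 - s)^-1 * (b - c) ^+ 2 - (a - c) ^+ 2 =
   ((1 - s) * (a - b) - s * (b - c)) ^+ 2 * (s^-1 * (1 - s)^-1).
  by field; rewrite !gt_eqF.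
by rewrite mulr_ge0 ?sqr_ge0 // mulr_ge0 // invr_ge0 ltW.
Qed.

(** * Minimizers of strongly convex functions *)

Definition convex_fun (R : realType) (n : nat) (f : 'cV[R]_n -> R) : Prop :=
  forall (x y : 'cV[R]_n) (a : R), 0 <= a -> a <= 1 ->
    f (a *: x + (1 - a) *: y) <= a * f x + (1 - a) * f y.

Lemma strongly_convexW (R : realType) (n : nat) (mu : R) (f : 'cV[R]_n -> R) :
  0 <= mu -> strongly_convex mu f -> convex_fun f.
Proof.
move=> mu0 fC x y a a0 a1; apply: (le_trans (fC x y a a0 a1)).
rewrite gerBl !mulr_ge0 ?sqnorm2_ge0 //; lra.
Qed.

(** Induction on the coordinates that may move: [x + u + v] is the mean of
    [x + 2 u] and [x + 2 v], which is why [c] has to be universally quantified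
    in the induction hypothesis. *)
Lemma convex_bounded_cube (R : realType) (n : nat) (f : 'cV[R]_n -> R)
    (x : 'cV[R]_n) (s : seq 'I_n) (c : R) :
  (forall y, 0 <= f y) -> convex_fun f -> 0 < c ->
  exists M, forall u : 'I_n -> R, (forall k, `|u k| <= c) ->
    f (x + \sum_(k <- s) u k *: delta_mx k 0) <= M.
Proof.
move=> f0 fC; elim: s c => [|k s IH] c c0.
  by exists (f x) => u _; rewrite big_nil addr0.
have c20 : 0 < 2 * c by lra.
have [M HM] := IH _ c20.
pose p b : 'cV[R]_n := x + b *: delta_mx k 0.
exists (2^-1 * (f (p (2 * c)) + f (p (- (2 * c)))) + 2^-1 * M) => u uc.
rewrite big_cons; set S := \sum_(_ <- _) _.
have -> : x + (u k *: delta_mx k 0 + S) =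
    2^-1 *: p (2 * u k) +
    (1 - 2^-1) *: (x + \sum_(j <- s) (2 * u j) *: delta_mx j 0).
  have -> : \sum_(j <- s) (2 * u j) *: delta_mx j 0 = 2 *: S :> 'cV[R]_n.
    by rewrite scaler_sumr; apply: eq_bigr => j _; rewrite scalerA.
  by apply/colP => j; rewrite !mxE; field.
apply: (le_trans (fC _ _ _ _ _)); [lra|lra|].
have -> : 1 - 2^-1 = 2^-1 :> R by field.
apply: lerD; rewrite ler_pM2l ?invr_gt0 //; last first.
  apply: HM => j; rewrite normrM ger0_norm // ler_pM2l //; exact: uc.
(* On a segment, [f] is bounded by the sum of its values at the ends. *)
have /andP[uk1 uk2] : - c <= u k <= c by rewrite -ler_norml.
pose a := (2 * u k + 2 * c) / (4 * c).
have a0 : 0 <= a by rewrite divr_ge0 //; lra.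
have a1 : a <= 1 by rewrite ler_pdivrMr; lra.
have -> : p (2 * u k) = a *: p (2 * c) + (1 - a) *: p (- (2 * c)).
  apply/colP => j; rewrite !mxE /a; field; by rewrite gt_eqF.
apply: (le_trans (fC _ _ _ a0 a1)); apply: lerD.
  by rewrite ler_piMl.
by rewrite ler_piMl // gerBl.
Qed.

(** The point [x] lies between [y] and a point [w] on the opposite side, in
    the cube of half-width 1 around [x].  As [f] is bounded on this cube,
    convexity bounds [f x] by [f y] plus a multiple of the distance from [y] to
    [x]. *)
Lemma convex_lsc (R : realType) (n : nat) (f : 'cV[R]_n -> R)
    (x : 'cV[R]_n) (e : R) :
  (forall y, 0 <= f y) -> convex_fun f -> 0 < e ->
  exists2 del : R, 0 < del & forall y : 'cV[R]_n,
    (forall k, `|y k 0 - x k 0| <= del) -> f x <= f y + e.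
Proof.
move=> f0 fC e0.
have [M HM] := convex_bounded_cube x (index_enum 'I_n) f0 fC ltr01.
have M0 : 0 <= M.
  by apply: le_trans (f0 _) (HM (fun=> 0) _) => k; rewrite normr0.
have M10 : 0 < 1 + M by lra.
have d0 : 0 < e / (1 + M) by rewrite divr_gt0.
exists (e / (1 + M)) => // y xy; move: d0 xy.
set del := e / (1 + M) => d0 xy.
have d1 : 0 < 1 + del by lra.
pose a := (1 + del)^-1.
pose u k := - (y k 0 - x k 0) / del.
have := HM u; set w := x + _ => Hw.
have {Hw} fw : f w <= M.
  apply: Hw => k; rewrite /u normrM normrN normfV (gtr0_norm d0).
  by rewrite ler_pdivrMr // mul1r.
have a0 : 0 <= a by rewrite invr_ge0 ltW.
have a1 : a <= 1 by rewrite invf_le1 //; lra.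
have xE : x = a *: y + (1 - a) *: w.
  apply/colP => k; rewrite /w !mxE summxE (bigD1 k) //= big1 => [|j jk].
    rewrite !mxE !eqxx /= mulr1 addr0 /u /a; field.
    by rewrite !gt_eqF //.
  by rewrite !mxE eq_sym (negbTE jk) mulr0.
rewrite {1}xE; apply: (le_trans (fC _ _ _ a0 a1)).
apply: lerD; first by rewrite ler_piMl.
apply: (@le_trans _ _ (del * M)).
  apply: ler_pM => //; first lra.
  rewrite /a; have -> : 1 - (1 + del)^-1 = del / (1 + del).
    by field; rewrite gt_eqF.
  by rewrite ler_piMr ?(ltW d0) // invf_le1 // lerDl (ltW d0).
have -> : e = del * (1 + M) by rewrite /del; field; rewrite gt_eqF.
by rewrite ler_pM2l //; lra.
Qed.

(** The value of [f] at the midpoint of two nearly optimal points is at least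
    the infimum, so strong convexity forces these points to be close: a
    minimizing sequence is Cauchy.  Lower semicontinuity identifies the value
    at its limit. *)
Lemma strongly_convex_argmin (R : realType) (n : nat) (mu : R)
    (f : 'cV[R]_n -> R) :
  0 < mu -> (forall x, 0 <= f x) -> strongly_convex mu f ->
  exists x, forall y, f x <= f y.
Proof.
move=> mu0 f0 fC.
have hinf : has_inf (range f).
  by split; [exists (f 0), 0 | exists 0 => _ [x _ <-]].
pose s := inf (range f).
have sle y : s <= f y by apply: (ge_inf hinf.2); exists y.
have /choice[u Hu] (k : nat) : exists x, f x < s + k.+1%:R^-1.
  have [|_ [x _ <-] fx] := @inf_adherent _ (range f) k.+1%:R^-1 _ hinf.
    by rewrite invr_gt0.
  by exists x.
(* Strong convexity at the midpoint of [u j] and [u k]. *)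
have gap j k : (j <= k)%N -> mu / 8 * sqnorm2 (u j - u k) <= j.+1%:R^-1.
  move=> jk.
  have h0 : (0 : R) <= 2^-1 by rewrite invr_ge0.
  have h1 : 2^-1 <= 1 :> R by rewrite invf_le1 // ler1n.
  have := le_trans (sle _) (fC (u j) (u k) _ h0 h1).
  have := Hu j; have := Hu k.
  have : k.+1%:R^-1 <= j.+1%:R^-1 :> R by rewrite lef_pV2 ?posrE // ler_nat.
  move: (sqnorm2 _) (k.+1%:R^-1) (j.+1%:R^-1) (f (u j)) (f (u k)).
  move=> q b c fj fk.
  lra.
have : cvg (u @ \oo).
  apply/cauchy_cvgP/cauchyP => e e0.
  (* From this rank on, [gap] puts squared distances below [e ^+ 2]. *)
  pose j := Num.trunc (8 / (mu * e ^+ 2)).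
  exists (u j); exists j => // k /= jk.
  split=> // i i0; rewrite /ball /= (ord1 i0).
  have me0 : 0 < mu * e ^+ 2 by rewrite mulr_gt0 // exprn_gt0.
  have Hj : 8 / (mu * e ^+ 2) < j.+1%:R by rewrite truncnS_gt.
  rewrite -(ltr_pXn2r (n := 2)) ?nnegrE ?normr_ge0 ?ltW //.
  rewrite real_normK ?num_real //.
  have -> : u j i 0 - u k i 0 = (u j - u k) i 0 by rewrite !mxE.
  apply: (le_lt_trans (sqnorm2_coord _ _)).
  rewrite -(ltr_pM2l (x := mu / 8)) ?divr_gt0 //.
  apply: (le_lt_trans (gap _ _ jk)).
  rewrite invf_plt ?posrE ?divr_gt0 ?mulr_gt0 ?exprn_gt0 //.
  by have -> : (mu / 8 * e ^+ 2)^-1 = 8 / (mu * e ^+ 2)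
    by field; rewrite !gt_eqF.
move=> /cvg_ex[x ux]; exists x => y; apply: (le_trans _ (sle y)).
apply/ler_addgt0Pr => e e0.
have e20 : 0 < e / 2 by rewrite divr_gt0.
have [del del0 lsc] := convex_lsc x f0 (strongly_convexW (ltW mu0) fC) e20.
have : \forall k \near \oo, f x <= s + e.
  near=> k.
  have fxk : f x <= f (u k) + e / 2.
    apply: lsc => i; rewrite distrC ltW //.
    have : ball x del (u k) by near: k; apply: ux; apply: nbhsx_ballx.
    by case=> _ /(_ i 0).
  apply: (le_trans fxk); rewrite {2}(splitr e) addrA lerD2r ltW //.
  apply: (lt_trans (Hu k)); rewrite ltrD2l; near: k.
  have /cvgrPdist_lt/(_ _ e20) := @cvg_harmonic R; apply: filterS => k.
  by rewrite sub0r normrN gtr0_norm ?invr_gt0.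
by move=> [k _]; apply; apply: leqnn.
Unshelve. all: by end_near.
Qed.

(** Quadratic growth at a minimizer, reduced to real numbers: [u] is the minimal
    value, [v] another value, and the hypothesis is strong convexity along the
    segment between the two points.  Dividing by [a] and letting [a] tend to 0
    gives the claim. *)
Lemma argmin_quadratic_growth (R : realFieldType) (u v Q : R) :
  0 <= Q ->
  (forall a, 0 < a -> a < 1 -> u <= a * v + (1 - a) * u - a * (1 - a) * Q) ->
  u + Q <= v.
Proof.
move=> Q0 H; rewrite leNgt; apply/negP => h.
pose g := u + Q - v; have g0 : 0 < g by rewrite /g; lra.
(* Small enough for the error term [a * Q] to stay below the gap [g]. *)
pose a := g / (2 * (Q + g)).
have D0 : 0 < 2 * (Q + g) by lra.
have a0 : 0 < a by rewrite divr_gt0.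
have a1 : a < 1 by rewrite ltr_pdivrMr; lra.
have aQ : a * Q < g.
  rewrite /a mulrAC ltr_pdivrMr //; nra.
have : 0 <= a * (v - u - (1 - a) * Q) by have := H a a0 a1; lra.
rewrite pmulr_rge0 //; rewrite /g in aQ *; lra.
Qed.

(** * The weight of the movement cost *)

Lemma lambda1_gt0 (R : realType) (mu : R) : 0 < lambda1 mu.
Proof. by rewrite divr_gt0 // ltr_pwDl // sqrtr_ge0. Qed.

Lemma lambda1_lt1 (R : realType) (mu : R) : 0 < mu -> lambda1 mu < 1.
Proof.
move=> mu0; rewrite /lambda1 ltr_pdivrMr ?ltr_pwDl ?sqrtr_ge0 // mul1r.
have : 1 < Num.sqrt (1 + 4 / mu); last lra.
by rewrite -[ltLHS]sqrtr1 ltr_sqrt ?ltrDl ?divr_gt0 // addr_gt0 // divr_gt0.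
Qed.

Lemma lambda1_quadratic (R : realType) (mu : R) :
  0 < mu -> lambda1 mu ^+ 2 = mu * (1 - lambda1 mu).
Proof.
move=> mu0; rewrite /lambda1; set q := Num.sqrt _.
have q0 : 0 <= q by rewrite sqrtr_ge0.
have q2 : q ^+ 2 = 1 + 4 / mu.
  by rewrite sqr_sqrtr // addr_ge0 // divr_ge0 // ltW.
have -> : mu = 4 / (q ^+ 2 - 1).
  by rewrite q2 addrAC subrr add0r invf_div mulrC divfK ?pnatr_eq0.
have q1 : q ^+ 2 - 1 != 0.
  by rewrite q2 addrAC subrr add0r gt_eqF // divr_gt0.
field; rewrite q1 andbT gt_eqF //; lra.
Qed.

Lemma lambda1_le (R : realType) (mu nu : R) :
  0 < mu -> mu <= nu -> lambda1 mu <= lambda1 nu.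
Proof.
move=> mu0 munu; have nu0 := lt_le_trans mu0 munu.
rewrite /lambda1 ler_pM2l // lef_pV2 ?posrE ?ltr_pwDl ?sqrtr_ge0 // lerD2l.
by rewrite ler_wsqrtr // lerD2l ler_pM2l // lef_pV2.
Qed.

Lemma invr_lambda1 (R : realType) (mu : R) :
  (lambda1 mu)^-1 = 2^-1 + 2^-1 * Num.sqrt (1 + 4 / mu).
Proof.
rewrite /lambda1; set q := Num.sqrt _; have q0 : 0 <= q by rewrite sqrtr_ge0.
field; rewrite gt_eqF //; lra.
Qed.

(** * The minimization problem of one round *)

Definition interaction (R : realType) (N d : nat) (beta : R)
    (rd : round R N d) (x : action R N d) : R :=
  beta / 2 * \sum_(e in edges rd)
    sqnorm2 (link rd e *m x e.1 - link rd e *m x e.2).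

(** The objective of a round once the edge variables are minimized out; see
    [round_objectiveE]. *)
Definition reduced_objective (R : realType) (N d : nat) (beta : R)
    (mu : 'I_N -> R) (rd : round R N d) (xprev x : action R N d) : R :=
  \sum_(i < N) (hit rd i (x i) + lambda1 (mu i) / 2 * sqnorm2 (x i - xprev i)) +
  interaction beta rd x.

Definition midpoint (R : realType) (N d : nat) (rd : round R N d)
    (x : action R N d) (e : edge rd) : 'cV[R]_d :=
  2^-1 *: (x (val e).1 + x (val e).2).

Lemma interaction_ge0 (R : realType) (N d : nat) (beta : R)
    (rd : round R N d) (x : action R N d) :
  0 < beta -> 0 <= interaction beta rd x.
Proof.
move=> beta0; rewrite mulr_ge0 ?divr_ge0 ?(ltW beta0) //.
by apply: sumr_ge0 => e _; apply: sqnorm2_ge0.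
Qed.

Lemma reduced_objective_ge0 (R : realType) (N d : nat) (beta m l : R)
    (mu : 'I_N -> R) (rd : round R N d) (xprev x : action R N d) :
  0 < beta -> valid_round m l mu rd ->
  0 <= reduced_objective beta mu rd xprev x.
Proof.
move=> beta0 [f0 _ _ _ _]; rewrite addr_ge0 ?interaction_ge0 //.
apply: sumr_ge0 => i _; rewrite addr_ge0 // mulr_ge0 ?sqnorm2_ge0 //.
by rewrite divr_ge0 // ltW // lambda1_gt0.
Qed.

Lemma reduced_objective_convex (R : realType) (N d : nat) (beta m l : R)
    (mu : 'I_N -> R) (rd : round R N d) (xprev x y : action R N d) (a : R) :
  0 < beta -> valid_round m l mu rd -> 0 <= a -> a <= 1 ->
  reduced_objective beta mu rd xprev (fun i => a *: x i + (1 - a) *: y i) <=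
  a * reduced_objective beta mu rd xprev x +
  (1 - a) * reduced_objective beta mu rd xprev y -
  a * (1 - a) * \sum_(i < N) (mu i + lambda1 (mu i)) / 2 * sqnorm2 (x i - y i).
Proof.
move=> beta0 [_ fC _ _ _] a0 a1; rewrite /reduced_objective.
have a10 : 0 <= 1 - a by lra.
have : interaction beta rd (fun i => a *: x i + (1 - a) *: y i) <=
    a * interaction beta rd x + (1 - a) * interaction beta rd y.
  rewrite /interaction !(mulrCA _ (beta / 2)) -mulrDr ler_pM2l ?divr_gt0 //.
  rewrite !mulr_sumr -big_split /=; apply: ler_sum => e _.
  have -> : link rd e *m (a *: x e.1 + (1 - a) *: y e.1) -
            link rd e *m (a *: x e.2 + (1 - a) *: y e.2) =
      a *: (link rd e *m x e.1 - link rd e *m x e.2) +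
      (1 - a) *: (link rd e *m y e.1 - link rd e *m y e.2).
    rewrite !mulmxDr -!scalemxAr !scalerBr opprD.
    by rewrite -!addrA; congr (_ + _); rewrite addrCA.
  by rewrite sqnorm2_convex gerBl !mulr_ge0 ?sqnorm2_ge0.
have : \sum_(i < N) (hit rd i (a *: x i + (1 - a) *: y i) +
      lambda1 (mu i) / 2 * sqnorm2 (a *: x i + (1 - a) *: y i - xprev i)) <=
    a * \sum_(i < N)
      (hit rd i (x i) + lambda1 (mu i) / 2 * sqnorm2 (x i - xprev i)) +
    (1 - a) * \sum_(i < N)
      (hit rd i (y i) + lambda1 (mu i) / 2 * sqnorm2 (y i - xprev i)) -
    a * (1 - a) *
      \sum_(i < N) (mu i + lambda1 (mu i)) / 2 * sqnorm2 (x i - y i).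
  rewrite !mulr_sumr -big_split -sumrB /=; apply: ler_sum => i _.
  have := fC i (x i) (y i) a a0 a1.
  have -> : a *: x i + (1 - a) *: y i - xprev i =
      a *: (x i - xprev i) + (1 - a) *: (y i - xprev i).
    by apply/colP => k; rewrite !mxE; ring.
  rewrite sqnorm2_convex.
  have -> : x i - xprev i - (y i - xprev i) = x i - y i.
    by apply/colP => k; rewrite !mxE; ring.
  lra.
lra.
Qed.

Lemma reduced_objective_growth (R : realType) (N d : nat) (beta m l : R)
    (mu : 'I_N -> R) (rd : round R N d) (xprev x y : action R N d) :
  0 < beta -> (forall i, 0 < mu i) -> valid_round m l mu rd ->
  (forall w, reduced_objective beta mu rd xprev x <=
             reduced_objective beta mu rd xprev w) ->
  reduced_objective beta mu rd xprev x +
    \sum_(i < N) (mu i + lambda1 (mu i)) / 2 * sqnorm2 (y i - x i) <=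
  reduced_objective beta mu rd xprev y.
Proof.
move=> beta0 mu0 rdV xmin; apply: argmin_quadratic_growth => [|a a0 a1].
  apply: sumr_ge0 => i _; rewrite mulr_ge0 ?sqnorm2_ge0 // divr_ge0 //.
  by rewrite addr_ge0 // ltW // lambda1_gt0.
apply: (le_trans (xmin _)).
exact: (reduced_objective_convex xprev y x beta0 rdV (ltW a0) (ltW a1)).
Qed.

(** The joint actions are flattened into vectors indexed by the pairs (agent,
    coordinate), an identification that preserves squared norms. *)
Lemma reduced_objective_argmin (R : realType) (N d : nat) (beta m l mu0 : R)
    (mu : 'I_N -> R) (rd : round R N d) (xprev : action R N d) :
  0 < beta -> 0 < mu0 -> (forall i, mu0 <= mu i) -> valid_round m l mu rd ->
  exists x, forall y, reduced_objective beta mu rd xprev x <=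
                      reduced_objective beta mu rd xprev y.
Proof.
move=> beta0 mu00 mule rdV.
pose unflatten (v : 'cV[R]_#|{: 'I_N * 'I_d}|) : action R N d :=
  fun i => \col_k v (enum_rank (i, k)) 0.
have sqnorm2_unflatten v : sqnorm2 v = \sum_(i < N) sqnorm2 (unflatten v i).
  rewrite /sqnorm2 (reindex (@enum_rank _)) /=; last first.
    by apply: onW_bij; apply: enum_rank_bij.
  rewrite pair_bigA /=; apply: eq_bigr => -[i k] _.
  by rewrite mxE.
have [|||v vmin] := @strongly_convex_argmin R _ mu0
    (fun v => reduced_objective beta mu rd xprev (unflatten v)).
- by [].
- by move=> v; apply: reduced_objective_ge0 rdV.
- move=> v w a a0 a1.
  have -> : unflatten (a *: v + (1 - a) *: w) =
      (fun i => a *: unflatten v i + (1 - a) *: unflatten w i).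
    by apply/funext => i; apply/colP => k; rewrite !mxE.
  apply: (le_trans (reduced_objective_convex _ _ _ beta0 rdV a0 a1)).
  rewrite lerD2l lerN2.
  have -> : mu0 / 2 * a * (1 - a) * sqnorm2 (v - w) =
      a * (1 - a) * (mu0 / 2 * sqnorm2 (v - w)) by ring.
  apply: ler_wpM2l; first by rewrite mulr_ge0 ?subr_ge0.
  rewrite sqnorm2_unflatten mulr_sumr; apply: ler_sum => i _.
  have -> : unflatten (v - w) i = unflatten v i - unflatten w i.
    by apply/colP => k; rewrite !mxE.
  rewrite ler_wpM2r ?sqnorm2_ge0 // ler_pM2r ?invr_gt0 //.
  by rewrite (le_trans (mule i)) // lerDl ltW // lambda1_gt0.
exists (unflatten v) => y.
have -> : y = unflatten (\col_s y (enum_val s).1 (enum_val s).2 0) => //.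
by apply/funext => i; apply/colP => k; rewrite !mxE enum_rankK.
Qed.

(** Each edge appears in the terms of its two endpoints, which are distinct;
    Apollonius's identity splits the pair into the coupling of the
    endpoints, with half its weight, and the distance from [z e] to their
    midpoint. *)
Lemma round_objectiveE (R : realType) (N d : nat) (beta : R)
    (mu : 'I_N -> R) (rd : round R N d) (xprev x : action R N d)
    (z : edge rd -> 'cV[R]_d) :
  (forall e, e \in edges rd -> (e.1 < e.2)%N) ->
  round_objective beta mu xprev x z =
  reduced_objective beta mu rd xprev x +
  2 * beta * \sum_(e : {e | e \in edges rd})
    sqnorm2 (link rd (val e) *m (midpoint x e - z e)).
Proof.
move=> rdE; rewrite /round_objective big_split /= /reduced_objective -addrA.
congr (_ + _); rewrite -mulr_sumr (exchange_big_dep predT) //=.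
rewrite /interaction (big_sub (edges rd)) /=.
rewrite [2 * beta]mulrC -!mulrA -mulrDr.
congr (_ * _); rewrite !mulr_sumr -big_split /=.
apply: eq_bigr => -[e eE] _ /=; have e12 := rdE e eE.
have e21 : e.2 != e.1 by rewrite neq_ltn e12 orbT.
rewrite (bigD1 e.1) ?eqxx //= (bigD1 e.2) ?eqxx ?orbT //=.
rewrite big1 => [|i]; last first.
  by case/andP=> /andP[/orP[->//|->]]; rewrite ?andbF.
rewrite addr0 sqnorm2_apollonius /midpoint /=.
by rewrite mulmxBr -scalemxAr mulmxDr.
Qed.

Lemma mulmx_full_rank_eq0 (R : realType) (r d : nat) (A : 'M[R]_(r, d))
    (v : 'cV[R]_d) : \rank A = d -> A *m v = 0 -> v = 0.
Proof.
move=> rA /(congr1 trmx); rewrite trmx_mul trmx0 => /eqP.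
rewrite mulmx_free_eq0 /row_free ?mxrank_tr ?rA // => /eqP /(congr1 trmx).
by rewrite trmxK trmx0.
Qed.

Lemma is_argmin_reduced (R : realType) (N d : nat) (beta m l : R)
    (mu : 'I_N -> R) (rd : round R N d) (xprev : action R N d)
    (xz : action R N d * (edge rd -> 'cV[R]_d)) :
  0 < beta -> valid_round m l mu rd ->
  is_argmin beta mu xprev xz <->
  (forall y, reduced_objective beta mu rd xprev xz.1 <=
             reduced_objective beta mu rd xprev y) /\ xz.2 = midpoint xz.1.
Proof.
move=> beta0 rdV; have [_ _ rdE _ rdA] := rdV; case: xz => x z /=.
have pen0 (y : action R N d) (w : edge rd -> 'cV[R]_d) :
    0 <= 2 * beta * \sum_(e : {e | e \in edges rd})
      sqnorm2 (link rd (val e) *m (midpoint y e - w e)).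
  rewrite !mulr_ge0 ?(ltW beta0) //.
  by apply: sumr_ge0 => e _; apply: sqnorm2_ge0.
have midE (y : action R N d) :
    round_objective beta mu xprev y (midpoint y : edge rd -> _) =
    reduced_objective beta mu rd xprev y.
  rewrite round_objectiveE // big1 ?mulr0 ?addr0 // => e _.
  by rewrite subrr mulmx0 sqnorm20.
split=> [xzmin|[xmin ->] y w].
  have xmin y : reduced_objective beta mu rd xprev x <=
                reduced_objective beta mu rd xprev y.
    have := xzmin y (midpoint y); rewrite midE /= round_objectiveE //.
    by apply: le_trans; rewrite lerDl.
  split=> //; apply/funext => e.
  have := xzmin x (midpoint x); rewrite midE /= round_objectiveE // gerDl.
  rewrite pmulr_rle0 ?mulr_gt0 // => S0.
  have ez : sqnorm2 (link rd (val e) *m (midpoint x e - z e)) <= 0.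
    apply: le_trans S0; rewrite (bigD1 e) //= lerDl.
    by apply: sumr_ge0 => j _; apply: sqnorm2_ge0.
  apply/esym/subr0_eq.
  exact: mulmx_full_rank_eq0 (rdA _ (valP e)).1 (sqnorm2_le0 ez).
rewrite /= midE round_objectiveE // (le_trans (xmin y)) // lerDl; exact: pen0.
Qed.

Lemma argmin_exists_unique (R : realType) (N d : nat) (beta m l mu0 : R)
    (mu : 'I_N -> R) (rd : round R N d) (xprev : action R N d) :
  0 < beta -> 0 < mu0 -> (forall i, mu0 <= mu i) -> valid_round m l mu rd ->
  exists! xz : action R N d * (edge rd -> 'cV[R]_d), is_argmin beta mu xprev xz.
Proof.
move=> beta0 mu00 mule rdV.
have mupos i : 0 < mu i by apply: lt_le_trans (mule i).
have [x xmin] := reduced_objective_argmin xprev beta0 mu00 mule rdV.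
exists (x, midpoint x); split; first by apply/(is_argmin_reduced _ _ beta0 rdV).
move=> [y w] /(is_argmin_reduced _ _ beta0 rdV)/= [ymin ->].
suff -> : y = x by [].
apply/funext => i; apply/subr0_eq/sqnorm2_le0.
have := le_trans (reduced_objective_growth y beta0 mupos rdV xmin) (ymin x).
rewrite gerDl (bigD1 i) //= => S0.
have ci : 0 < (mu i + lambda1 (mu i)) / 2.
  by rewrite divr_gt0 // addr_gt0 // lambda1_gt0.
rewrite -(pmulr_rle0 _ ci); apply: le_trans S0; rewrite lerDl.
apply: sumr_ge0 => j _; rewrite mulr_ge0 ?sqnorm2_ge0 // divr_ge0 //.
by rewrite addr_ge0 // ltW // lambda1_gt0.
Qed.

(** * The upper bound *)

Definition potential (R : realType) (N d : nat) (mu : 'I_N -> R)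
    (y x : action R N d) : R :=
  \sum_(i < N) (mu i + lambda1 (mu i)) / 2 * sqnorm2 (y i - x i).

(** The weight [lambda1 mu] is chosen for this inequality: Young's inequality
    with parameter [lam] gives the second coefficient [lam / (1 - lam)], which
    the quadratic equation of [lam] turns into [mu + lam]. *)
Lemma lambda1_young (R : realType) (d : nat) (mu : R) (x y z : 'cV[R]_d) :
  0 < mu ->
  lambda1 mu / 2 * sqnorm2 (x - z) <=
  2^-1 * sqnorm2 (x - y) + (mu + lambda1 mu) / 2 * sqnorm2 (y - z).
Proof.
move=> mu0; have l0 := lambda1_gt0 mu; have l1 := lambda1_lt1 mu0.
have lam01 : 0 < lambda1 mu < 1 by rewrite l0.
have -> : mu + lambda1 mu = lambda1 mu / (1 - lambda1 mu).
  apply: (canRL (mulfK _)); first by rewrite subr_eq0 gt_eqF.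
  by rewrite mulrDl -lambda1_quadratic //; ring.
have := sqnorm2_young x y z lam01; rewrite -(ler_pM2l (x := lambda1 mu / 2)).
  move/le_trans; apply; rewrite le_eqVlt; apply/orP; left; apply/eqP.
  by field; rewrite !gt_eqF ?subr_gt0.
by rewrite divr_gt0.
Qed.

(** The competitor [y] of the growth inequality moves from [xprev]; by
    [lambda1_young], moving from [yprev] instead costs the potential of the
    previous round.  Multiplication by [(lambda1 mu0)^-1] makes the movement
    weights of all agents at least 1/2, since [lambda1] is increasing; the
    factor must be common to all agents because the coupling is. *)
Lemma argmin_round_le (R : realType) (N d : nat) (beta m l mu0 : R)
    (mu : 'I_N -> R) (rd : round R N d) (xprev x yprev y : action R N d) :
  0 < beta -> 0 < mu0 -> (forall i, mu0 <= mu i) -> valid_round m l mu rd ->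
  (forall w, reduced_objective beta mu rd xprev x <=
             reduced_objective beta mu rd xprev w) ->
  round_cost beta rd xprev x + (lambda1 mu0)^-1 * potential mu y x <=
  (lambda1 mu0)^-1 * (round_cost beta rd yprev y + potential mu yprev xprev).
Proof.
move=> beta0 mu00 mule rdV xmin; have [f0 _ _ _ _] := rdV.
have mupos i : 0 < mu i by apply: lt_le_trans (mule i).
have l0 := lambda1_gt0 mu0; set c := (lambda1 mu0)^-1.
have c0 : 0 < c by rewrite invr_gt0.
have c1 : 1 <= c by rewrite invf_ge1 // ltW // lambda1_lt1.
have cl i : 1 <= c * lambda1 (mu i).
  by rewrite mulrC ler_pdivlMr // mul1r; apply: lambda1_le.
have xle : round_cost beta rd xprev x <=
    c * reduced_objective beta mu rd xprev x.
  rewrite /round_cost /reduced_objective mulrDr; apply: lerD; last first.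
    by rewrite ler_peMl // interaction_ge0.
  rewrite mulr_sumr; apply: ler_sum => i _; rewrite mulrDr; apply: lerD.
    by rewrite ler_peMl.
  move: (cl i); move: (lambda1 _) => lam clam.
  by rewrite !mulrA ler_wpM2r ?sqnorm2_ge0 // ler_peMl ?invr_ge0 ?ler0n.
have yle : reduced_objective beta mu rd xprev y <=
    round_cost beta rd yprev y + potential mu yprev xprev.
  rewrite /round_cost /reduced_objective addrAC lerD2r -big_split /=.
  apply: ler_sum => i _; rewrite -addrA lerD2l; exact: lambda1_young.
have grow := reduced_objective_growth y beta0 mupos rdV xmin.
apply: (@le_trans _ _
  (c * (reduced_objective beta mu rd xprev x + potential mu y x))).
  by rewrite mulrDr lerD2r.
by rewrite ler_pM2l // (le_trans grow).
Qed.

Lemma trajectory_argminS (R : realType) (N d : nat) (beta : R)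
    (x0 : action R N d) (inst : instance R N d) (t : nat) :
  trajectory x0 (argmin_algorithm beta x0) inst t.+1 =
  argmin_step beta (modulus inst)
    (trajectory x0 (argmin_algorithm beta x0) inst t) (rounds inst t.+1).
Proof.
have iotaS : iota 1 t.+1 = iota 1 t ++ [:: t.+1]
  by rewrite -[t.+1]addn1 iotaD /= add1n addn1.
rewrite [LHS]/trajectory /argmin_algorithm iotaS map_cat foldl_cat /=.
by case: t {iotaS}.
Qed.

Lemma argmin_stepP (R : realType) (N d : nat) (beta m l mu0 : R)
    (mu : 'I_N -> R) (rd : round R N d) (xprev : action R N d) :
  0 < beta -> 0 < mu0 -> (forall i, mu0 <= mu i) -> valid_round m l mu rd ->
  forall w, reduced_objective beta mu rd xprev (argmin_step beta mu xprev rd) <=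
            reduced_objective beta mu rd xprev w.
Proof.
move=> beta0 mu00 mule rdV.
have [xz [xzmin _]] := argmin_exists_unique xprev beta0 mu00 mule rdV.
have := xgetI (xprev, fun=> 0)
  (P := [set xz | is_argmin beta mu xprev xz]) xzmin.
by move=> /(is_argmin_reduced _ _ beta0 rdV)[].
Qed.

(** Summation of [argmin_round_le]; the potential is zero at the start because
    the two trajectories have the same initial point. *)
Lemma argmin_algorithm_cost (R : realType) (N d : nat) (beta m l mu0 : R)
    (x0 : action R N d) (inst : instance R N d) (y : nat -> action R N d) :
  0 < beta -> 0 < mu0 -> instance_class m l mu0 inst -> y 0%N = x0 ->
  cost beta inst (trajectory x0 (argmin_algorithm beta x0) inst) <=
  (lambda1 mu0)^-1 * cost beta inst y.
Proof.
move=> beta0 mu00 [[_ mule] _ rdV] y0; rewrite /cost.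
set x := trajectory _ _ _; set mu := modulus inst in mule rdV *.
set c := (lambda1 mu0)^-1; have c0 : 0 < c by rewrite invr_gt0 lambda1_gt0.
have pot_ge0 n : 0 <= c * potential mu (y n) (x n).
  rewrite mulr_ge0 ?(ltW c0) //; apply: sumr_ge0 => i _.
  rewrite mulr_ge0 ?sqnorm2_ge0 // divr_ge0 // addr_ge0 //.
    by rewrite ltW // (lt_le_trans mu00).
  by rewrite ltW // lambda1_gt0.
suff H n : (n <= horizon inst)%N ->
    \sum_(1 <= t < n.+1) round_cost beta (rounds inst t) (x t.-1) (x t) +
      c * potential mu (y n) (x n) <=
    c * \sum_(1 <= t < n.+1) round_cost beta (rounds inst t) (y t.-1) (y t).
  by apply: le_trans (H _ (leqnn _)); rewrite lerDl.
elim: n => [_|n IH nT].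
  rewrite !big_geq // mulr0 add0r /potential big1 ?mulr0 // => i _.
  by rewrite y0 subrr sqnorm20 mulr0.
rewrite !(big_nat_recr n.+1) //= mulrDr.
have rdVn : valid_round m l mu (rounds inst n.+1) by apply: rdV; rewrite /= nT.
have := argmin_round_le (y n) (y n.+1) beta0 mu00 mule rdVn
  (argmin_stepP (x n) beta0 mu00 mule rdVn).
rewrite -trajectory_argminS -/x -/c mulrDr.
have := IH (ltnW nT); lra.
Qed.

Lemma argmin_algorithm_ratio (R : realType) (N d : nat) (beta m l mu0 : R)
    (x0 : action R N d) :
  0 < beta -> 0 < mu0 ->
  has_competitive_ratio beta m l mu0 x0 (argmin_algorithm beta x0)
    (lambda1 mu0)^-1.
Proof.
move=> beta0 mu00; exists (fun=> 0) => [|inst instC]; first exact: cvg_cst.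
rewrite addr0 mulrC ler_pdivlMr ?lambda1_gt0 // mulrC.
apply: lb_le_inf => [|_ [y y0 <-]]; first by eexists; exists (fun=> x0).
rewrite -ler_pdivlMl ?lambda1_gt0 //.
exact: argmin_algorithm_cost beta0 mu00 instC y0.
Qed.

(** * The lower bound *)

Definition tracking_round (R : realType) (N d : nat) (K : R)
    (a : action R N d) : round R N d :=
  @Round R N d (fun i x => K / 2 * sqnorm2 (x - a i)) finset.set0 d (fun=> 0).

(** The target [a] enters only in the last round, so that it can be chosen
    against the action of the algorithm in the round before. *)
Definition adversary (R : realType) (N d : nat) (mu0 : R) (x0 : action R N d)
    (T : nat) (K : R) (a : action R N d) : instance R N d :=
  Instance (fun=> mu0) T
    (fun t => if t == T then tracking_round K a else tracking_round mu0 x0).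

Lemma tracking_round_valid (R : realType) (N d : nat) (m l mu0 K : R)
    (a : action R N d) :
  0 < mu0 -> mu0 <= K -> valid_round m l (fun=> mu0) (tracking_round K a).
Proof.
move=> mu00 muK; split=> [i x|i x y t t0 t1|e|//|e] /=; rewrite ?inE //.
  by rewrite mulr_ge0 ?sqnorm2_ge0 // divr_ge0 // (le_trans (ltW mu00)).
have -> : t *: x + (1 - t) *: y - a i = t *: (x - a i) + (1 - t) *: (y - a i).
  by apply/colP => k; rewrite !mxE; ring.
rewrite sqnorm2_convex.
have -> : x - a i - (y - a i) = x - y by apply/colP => k; rewrite !mxE; ring.
rewrite -subr_ge0.
set p := sqnorm2 (x - a i); set q := sqnorm2 (y - a i); set r := sqnorm2 _.
have -> : t * (K / 2 * p) + (1 - t) * (K / 2 * q) - mu0 / 2 * t * (1 - t) * r -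
    K / 2 * (t * p + (1 - t) * q - t * (1 - t) * r) =
    (K - mu0) / 2 * (t * (1 - t) * r) by field.
by rewrite !mulr_ge0 ?divr_ge0 ?subr_ge0 ?sqnorm2_ge0 ?ler0n.
Qed.

Lemma tracking_round_cost (R : realType) (N d : nat) (beta K : R)
    (a xprev x : action R N d) :
  round_cost beta (tracking_round K a) xprev x =
  \sum_(i < N) (K / 2 * sqnorm2 (x i - a i) + 2^-1 * sqnorm2 (x i - xprev i)).
Proof. by rewrite /round_cost /= big_set0 mulr0 addr0. Qed.

Lemma adversary_class (R : realType) (N d : nat) (m l mu0 K : R)
    (x0 : action R N d) (T : nat) (a : action R N d) :
  (0 < N)%N -> (0 < T)%N -> 0 < mu0 -> mu0 <= K ->
  instance_class m l mu0 (adversary mu0 x0 T K a).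
Proof.
move=> N0 T0 mu00 muK; split=> //; first by split=> //; exists (Ordinal N0).
by move=> t _ /=; case: ifP => _; apply: tracking_round_valid.
Qed.

(** Before round [T] the algorithm has no information on the target. *)
Lemma trajectory_adversary (R : realType) (N d : nat) (mu0 K : R)
    (x0 : action R N d) (alg : online_algorithm R N d) (T : nat)
    (a b : action R N d) (t : nat) :
  (t < T)%N ->
  trajectory x0 alg (adversary mu0 x0 T K a) t =
  trajectory x0 alg (adversary mu0 x0 T K b) t.
Proof.
case: t => [//|t] tT; rewrite /trajectory; congr (alg _ _ _).
apply/eq_in_map => s; rewrite mem_iota /= add1n ltnS => /andP[_ st].
by rewrite ltn_eqF // (leq_ltn_trans st).
Qed.

Lemma cost_ge0 (R : realType) (N d : nat) (beta m l mu0 : R)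
    (inst : instance R N d) (x : nat -> action R N d) :
  0 < beta -> instance_class m l mu0 inst -> 0 <= cost beta inst x.
Proof.
move=> beta0 [_ _ rdV]; rewrite /cost big_seq; apply: sumr_ge0 => t.
rewrite mem_index_iota => /rdV[f0 _ _ _ _].
rewrite addr_ge0 ?interaction_ge0 //; apply: sumr_ge0 => i _.
by rewrite addr_ge0 // mulr_ge0 ?sqnorm2_ge0.
Qed.

Lemma opt_cost_ge0 (R : realType) (N d : nat) (beta m l mu0 : R)
    (x0 : action R N d) (inst : instance R N d) :
  0 < beta -> instance_class m l mu0 inst -> 0 <= opt_cost beta x0 inst.
Proof.
move=> beta0 instC; apply: lb_le_inf => [|_ [x _ <-]].
  by eexists; exists (fun=> x0).
exact: cost_ge0 instC.
Qed.

Lemma opt_cost_le (R : realType) (N d : nat) (beta m l mu0 : R)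
    (x0 : action R N d) (inst : instance R N d) (x : nat -> action R N d) :
  0 < beta -> instance_class m l mu0 inst -> x 0%N = x0 ->
  opt_cost beta x0 inst <= cost beta inst x.
Proof.
move=> beta0 instC x0E; apply: ge_inf; last by exists x.
by exists 0 => _ [y _ <-]; apply: cost_ge0 instC.
Qed.

(** Minimum over [x] of the cost of a jump, by the weighted Cauchy-Schwarz
    inequality: if [a] and [p] differ by at least one, then [x] is far from one
    of them. *)
Lemma jump_cost (R : realType) (d : nat) (K : R) (k : 'I_d)
    (x a p : 'cV[R]_d) :
  0 < K -> 1 <= (a k 0 - p k 0) ^+ 2 ->
  2^-1 * (1 - (1 + K)^-1) <=
  K / 2 * sqnorm2 (x - a) + 2^-1 * sqnorm2 (x - p).
Proof.
move=> K0 ap; have := sqnorm2_coord (x - a) k; have := sqnorm2_coord (x - p) k.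
rewrite !mxE; set u := x k 0 - a k 0; set v := x k 0 - p k 0 => vle ule.
have D0 : 0 < 1 + K by lra.
have uv : 1 - (1 + K)^-1 <= K * u ^+ 2 + v ^+ 2.
  have -> : K * u ^+ 2 + v ^+ 2 =
      ((K * u + v) ^+ 2 + K * (a k 0 - p k 0) ^+ 2) / (1 + K).
    by rewrite /u /v; field; rewrite gt_eqF.
  have -> : 1 - (1 + K)^-1 = K / (1 + K) by field; rewrite gt_eqF.
  rewrite ler_pM2r ?invr_gt0 // -[leLHS]add0r lerD ?sqr_ge0 //.
  by rewrite ler_peMr ?(ltW K0).
have : K * u ^+ 2 <= K * sqnorm2 (x - a) by rewrite ler_pM2l.
lra.
Qed.

(** Only the last round is counted: there [jump_cost] applies to every agent. *)
Lemma adversary_alg_cost (R : realType) (N d : nat) (beta m l mu0 K : R)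
    (x0 : action R N d) (alg : online_algorithm R N d) (T : nat)
    (a : action R N d) (k : 'I_d) :
  (0 < N)%N -> 0 < beta -> 0 < mu0 -> mu0 <= K ->
  (forall i, 1 <= (a i k 0 -
    trajectory x0 alg (adversary mu0 x0 T.+1 K a) T i k 0) ^+ 2) ->
  N%:R * (2^-1 * (1 - (1 + K)^-1)) <=
  cost beta (adversary mu0 x0 T.+1 K a)
    (trajectory x0 alg (adversary mu0 x0 T.+1 K a)).
Proof.
move=> N0 beta0 mu00 muK far.
have instC := adversary_class m l x0 a N0 (ltn0Sn T) mu00 muK.
set x := trajectory _ _ _ in far *.
rewrite /cost /= big_nat_recr //= eqxx tracking_round_cost.
rewrite -[leLHS]add0r lerD //.
  rewrite big_seq; apply: sumr_ge0 => t _.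
  case: ifP => _; rewrite tracking_round_cost.
    apply: sumr_ge0 => i _.
    by rewrite addr_ge0 // mulr_ge0 ?sqnorm2_ge0 // ?invr_ge0 ?divr_ge0 //
      (le_trans (ltW mu00)).
  apply: sumr_ge0 => i _.
  by rewrite addr_ge0 // mulr_ge0 ?sqnorm2_ge0 // ?invr_ge0 ?divr_ge0 // ltW.
rewrite mulr_natl -[N in leLHS]card_ord -sumr_const; apply: ler_sum => i _.
by apply: jump_cost (far i); apply: lt_le_trans muK.
Qed.

(** The offline trajectory stays at distance [(1 - lam) ^+ (T - t)] from the
    initial point in round [t], where [T = n.+2], and reaches the target in
    round [T].  For this rate, the cost accumulated up to round [t] grows like
    [(lam + mu0) / 2] times the squared distance, except for the excess of the
    first step, which starts from distance 0. *)
Lemma adversary_opt_cost (R : realType) (N d : nat) (beta m l mu0 K : R)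
    (x0 : action R N d) (n : nat) (s : 'I_N -> R) (k : 'I_d) :
  (0 < N)%N -> 0 < beta -> 0 < mu0 -> mu0 <= K -> (forall i, s i ^+ 2 = 1) ->
  opt_cost beta x0
    (adversary mu0 x0 n.+2 K (fun i => x0 i + s i *: delta_mx k 0)) <=
  N%:R * (2^-1 * (lambda1 mu0 + (1 - lambda1 mu0) ^+ n)).
Proof.
move=> N0 beta0 mu00 muK s1; set a := fun i => _.
have l0 := lambda1_gt0 mu0; have l1 := lambda1_lt1 mu00.
have lq := lambda1_quadratic mu00; set lam := lambda1 mu0 in l0 l1 lq *.
have lamE : (lam + mu0) * (1 - lam) ^+ 2 = lam * (1 - lam).
  by rewrite expr2 mulrA mulrDl -lq; ring.
have instC := adversary_class m l x0 a N0 (ltn0Sn n.+1) mu00 muK.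
pose h t : R := if t is 0%N then 0 else (1 - lam) ^+ (n.+2 - t).
pose y t : action R N d := fun i => x0 i + (s i * h t) *: delta_mx k 0.
have y0 : y 0%N = x0.
  by apply/funext => i; rewrite /y mulr0 scale0r addr0.
apply: (le_trans (opt_cost_le beta0 instC y0)).
have sqdelta (c : R) : sqnorm2 (c *: (delta_mx k 0 : 'cV[R]_d)) = c ^+ 2.
  rewrite /sqnorm2 (bigD1 k) //= big1 => [|j jk]; rewrite !mxE ?eqxx /=.
    by rewrite mulr1 addr0.
  by rewrite (negbTE jk) mulr0 expr0n.
have yx0 t i : sqnorm2 (y t i - x0 i) = h t ^+ 2.
  by rewrite /y addrC addKr sqdelta exprMn s1 mul1r.
have ya t i : sqnorm2 (y t i - a i) = (h t - 1) ^+ 2.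
  have -> : y t i - a i = (s i * (h t - 1)) *: delta_mx k 0.
    by apply/colP => j; rewrite /y /a !mxE; ring.
  by rewrite sqdelta exprMn s1 mul1r.
have yy t u i : sqnorm2 (y t i - y u i) = (h t - h u) ^+ 2.
  have -> : y t i - y u i = (s i * (h t - h u)) *: delta_mx k 0.
    by apply/colP => j; rewrite /y !mxE; ring.
  by rewrite sqdelta exprMn s1 mul1r.
have sumN (c : R) : \sum_(i < N) c = N%:R * c.
  by rewrite sumr_const card_ord mulr_natl.
set inst := adversary _ _ _ _ _.
have low t : (t < n.+2)%N -> round_cost beta (rounds inst t) (y t.-1) (y t) =
    N%:R * (mu0 / 2 * h t ^+ 2 + 2^-1 * (h t - h t.-1) ^+ 2).
  move=> tT; rewrite /= ltn_eqF // tracking_round_cost -sumN.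
  by apply: eq_bigr => i _; rewrite yx0 yy.
(* The second term pays for the first step, which is longer than the
   geometric progression requires. *)
have partial t : (t < n.+1)%N ->
    \sum_(1 <= u < t.+2) round_cost beta (rounds inst u) (y u.-1) (y u) <=
    N%:R * ((lam + mu0) / 2 * h t.+1 ^+ 2 + 2^-1 * (1 - lam) ^+ n.+1 ^+ 2).
  elim: t => [|t IH] tn.
    rewrite big_nat1 low // ler_pM2l ?ltr0n //= subr0 subn1 /=.
    have : 0 <= lam * (1 - lam) ^+ n.+1 ^+ 2.
      by rewrite mulr_ge0 ?sqr_ge0 // ltW.
    lra.
  rewrite big_nat_recr // low //.
  apply: (le_trans (lerD (IH (ltnW tn)) (lexx _))).
  rewrite -mulrDr ler_pM2l ?ltr0n //=.
  set r := (1 - lam) ^+ (n.+2 - t.+2); set q := _ ^+ n.+1 ^+ 2.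
  have -> : (1 - lam) ^+ (n.+2 - t.+1) = (1 - lam) * r.
    by rewrite -exprS subnSK // ltnW.
  rewrite le_eqVlt; apply/orP; left; apply/eqP.
  (* Regrouped for [lamE], which expresses that this rate is stationary. *)
  transitivity (r ^+ 2 / 2 * ((lam + mu0) * (1 - lam) ^+ 2) + 2^-1 * q +
    (mu0 / 2 * r ^+ 2 + 2^-1 * (r * lam) ^+ 2)).
    by field.
  by rewrite lamE; field.
rewrite /cost big_nat_recr //=.
apply: (le_trans (lerD (partial n (leqnn _)) (lexx _))).
rewrite eqxx tracking_round_cost.
rewrite (eq_bigr (fun=> 2^-1 * lam ^+ 2)) => [|i _]; last first.
  rewrite ya yy /= subnn subSnn expr0 expr1 subrr expr0n /= mulr0 add0r.
  by congr (_ * _); ring.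
rewrite sumN -mulrDr ler_pM2l ?ltr0n //= subSnn expr1.
have : (1 - lam) ^+ n.+1 ^+ 2 <= (1 - lam) ^+ n.
  rewrite -exprM ler_wiXn2l //; first lra.
  - lra.
  - by rewrite muln2 -addnn addSn ltnW // ltnS leq_addr.
by rewrite [_ / 2]mulrC -mulrA lamE; lra.
Qed.

(** The stiffness [mu0 + n] of the last cost grows with the horizon [n.+2], so
    that a single limit removes the additive term of the competitive ratio
    together with the defects of both cost estimates.  Passing from [C] to the
    maximum [C'] of [C] and 0 makes it legitimate to bound the offline cost
    from above before the sign of [C] is known. *)
Lemma competitive_ratio_ge (R : realType) (N d : nat) (beta m l mu0 : R)
    (x0 : action R N d) (alg : online_algorithm R N d) (C : R) :
  (0 < N)%N -> (0 < d)%N -> 0 < beta -> 0 < mu0 ->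
  has_competitive_ratio beta m l mu0 x0 alg C -> (lambda1 mu0)^-1 <= C.
Proof.
move=> N0 d0 beta0 mu00 [eps eps0 algC]; pose k := Ordinal d0.
have l0 := lambda1_gt0 mu0; have l1 := lambda1_lt1 mu00.
set lam := lambda1 mu0 in l0 l1 *; pose C' := Num.max C 0.
have C'0 : 0 <= C' by rewrite le_max lexx orbT.
have main n : N%:R * (2^-1 * (1 - n.+1%:R^-1)) <=
    C' * (N%:R * (2^-1 * (lam + (1 - lam) ^+ n))) + eps n.+2.
  pose K := mu0 + n%:R; have muK : mu0 <= K by rewrite lerDl.
  pose p := trajectory x0 alg (adversary mu0 x0 n.+2 K x0) n.+1.
  (* Jump away from the current position [p i] of the algorithm. *)
  pose s i : R := if x0 i k 0 <= p i k 0 then -1 else 1.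
  pose a : action R N d := fun i => x0 i + s i *: delta_mx k 0.
  have instC := adversary_class m l x0 a N0 (ltn0Sn n.+1) mu00 muK.
  have s1 i : s i ^+ 2 = 1 by rewrite /s; case: ifP; rewrite ?sqrrN expr1n.
  have far i : 1 <= (a i k 0 -
      trajectory x0 alg (adversary mu0 x0 n.+2 K a) n.+1 i k 0) ^+ 2.
    rewrite (trajectory_adversary _ _ _ _ _ x0) // -/p /a !mxE !eqxx /= mulr1.
    rewrite /s; case: (lerP (x0 i k 0) (p i k 0)) => h; nra.
  have := algC _ instC; have := adversary_alg_cost m l N0 beta0 mu00 muK far.
  move=> /le_trans /[apply] /= H.
  apply: (@le_trans _ _ (N%:R * (2^-1 * (1 - (1 + K)^-1)))).
    rewrite ler_pM2l ?ltr0n // ler_pM2l ?invr_gt0 //.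
    rewrite lerD2l lerN2 lef_pV2 ?posrE //.
      by rewrite /K -natr1; lra.
    by rewrite /K; have : 0 <= n%:R :> R by []; lra.
  apply: (le_trans H); rewrite lerD2r.
  have := adversary_opt_cost m l x0 n k N0 beta0 mu00 muK s1.
  move=> /(ler_wpM2l C'0); apply: le_trans.
  by rewrite ler_wpM2r ?(opt_cost_ge0 x0 beta0 instC) // le_max lexx.
have : N%:R * (2^-1 * (1 - 0)) <= C' * (N%:R * (2^-1 * (lam + 0))) + 0.
  apply: (@ler_cvg_to _ \oo _ R (fun n => N%:R * (2^-1 * (1 - n.+1%:R^-1)))
    (fun n => C' * (N%:R * (2^-1 * (lam + (1 - lam) ^+ n))) + eps n.+2)).
  - do 2!apply: cvgMr; apply: cvgB; [exact: cvg_cst|exact: cvg_harmonic].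
  - apply: cvgD.
      do 3!apply: cvgMr; apply: cvgD; first exact: cvg_cst.
      by apply: cvg_expr; rewrite ger0_norm; lra.
    rewrite -(cvg_shiftn 2) in eps0; move: eps0.
    by under eq_fun do rewrite addn2.
  - by apply: nearW.
rewrite addr0 subr0 mulr1 addr0 => H.
have Nr0 : 0 < N%:R :> R by rewrite ltr0n.
have lamC : 1 <= C' * lam.
  have : N%:R * (2^-1 * 1) <= N%:R * (2^-1 * (C' * lam)) by lra.
  by rewrite ler_pM2l // ler_pM2l ?invr_gt0.
have : lam^-1 <= C' by rewrite -[lam^-1]mul1r ler_pdivrMr.
by rewrite le_max => /orP[//|]; rewrite leNgt invr_gt0 l0.
Qed.

Theorem theoremB1 (R : realType) (N d : nat) (beta m l mu0 : R)
    (x0 : action R N d)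
    (hN : (0 < N)%N) (hd : (0 < d)%N) (hbeta : 0 < beta)
    (hm : 0 < m) (hml : m <= l) (hmu0 : 0 < mu0) :
  let ratio : R := 2^-1 + 2^-1 * Num.sqrt (1 + 4 / mu0) in
  [/\ forall (mu : 'I_N -> R) (rd : round R N d) (xprev : action R N d),
        is_min mu mu0 -> valid_round m l mu rd ->
        exists! xz : action R N d * (edge rd -> 'cV[R]_d),
          is_argmin beta mu xprev xz,
      has_competitive_ratio beta m l mu0 x0 (argmin_algorithm beta x0) ratio
    & forall (alg : online_algorithm R N d) (C : R),
        has_competitive_ratio beta m l mu0 x0 alg C -> ratio <= C].
Proof.
move=> ratio; have -> : ratio = (lambda1 mu0)^-1 by rewrite invr_lambda1.
split.
- move=> mu rd xprev [_ mule] rdV.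
  exact: argmin_exists_unique hbeta hmu0 mule rdV.
- exact: argmin_algorithm_ratio.
- by move=> alg C; apply: competitive_ratio_ge.
Qed.
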